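(* Consider an irreducible entropy game with irreducibility index $k_{\mathrm{irr}}$, minimal off-diagonal multiplicity $\underline m$ and ambiguity $\mathcal A$, and let $T_{\mathrm m,\vartheta}$ be its multiplicative Krasnoselskii-Mann operator with $\vartheta=\underline m$. Then $T_{\mathrm m,\vartheta}^{k_{\mathrm{irr}}}$ is a contraction in Hilbert's seminorm, with contraction rate bounded by $\frac{\bar{\mathcal M}-1}{\bar{\mathcal M}+1}$, where $\bar{\mathcal M}=(1+\mathcal A/\underline m)^{k_{\mathrm{irr}}}$; that is, for all $x,y\in\mathbb{R}^n$, $$\|T_{\mathrm m,\vartheta}^{k_{\mathrm{irr}}}(x)-T_{\mathrm m,\vartheta}^{k_{\mathrm{irr}}}(y)\|_{\mathrm H}\le\frac{\bar{\mathcal M}-1}{\bar{\mathcal M}+1}\,\|x-y\|_{\mathrm H}.$$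
   Context: Hilbert's seminorm on $\mathbb{R}^n$: $\|x\|_{\mathrm H}=\max_ix_i-\min_ix_i$. Entropy game: a finite digraph $(\mathscr V,\mathscr E)$ with a partition $\mathscr V=\mathscr V_D\uplus\mathscr V_T\uplus\mathscr V_P$ into nonempty sets of states of the players Despot, Tribune and People, $\mathscr E\subset(\mathscr V_D\times\mathscr V_T)\cup(\mathscr V_T\times\mathscr V_P)\cup(\mathscr V_P\times\mathscr V_D)$, every vertex having at least one outgoing edge; every edge $(p,d)\in\mathscr E\cap(\mathscr V_P\times\mathscr V_D)$ carries a multiplicity $m_{p,d}$, a positive integer (put $m_{p,d}=0$ if $(p,d)\notin\mathscr E$). Let $n=|\mathscr V_D|$. A (pure) policy $\sigma$ of Despot maps each $d\in\mathscr V_D$ to some $t$ with $(d,t)\in\mathscr E$; a policy $\tau$ of Tribune maps each $t\in\mathscr V_T$ to some $p$ with $(t,p)\in\mathscr E$. The pair determines the $n\times n$ matrix $M^{\sigma,\tau}_{d,d'}=m_{\tau(\sigma(d)),d'}$. The game is irreducible if all matrices $M^{\sigma,\tau}$ are irreducible. $\underline m$ is the minimum of all nonzero off-diagonal entries of the matrices $M^{\sigma,\tau}$ over all pairs of policies (presupposed to exist, automatic for $n\ge2$), and $\vartheta:=\underline m$. The irreducibility index $k_{\mathrm{irr}}$ is the smallest integer $k$ such that $(\vartheta I+M^{\sigma_1,\tau_1})\cdots(\vartheta I+M^{\sigma_k,\tau_k})$ has positive entries for all sequences of pairs of policies (such $k\le n$ exists). The $l$-ambiguity is $\mathcal A_l=\max_{d,d'\in\mathscr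 V_D}\max_{\sigma_1,\tau_1,\dots,\sigma_l,\tau_l}(M^{\sigma_1,\tau_1}\cdots M^{\sigma_l,\tau_l})_{d,d'}$ and the ambiguity is $\mathcal A=\max_{1\le l\le k_{\mathrm{irr}}}\mathcal A_l^{1/l}$. The multiplicative Krasnoselskii-Mann operator $T_{\mathrm m,\vartheta}:\mathbb{R}^n\to\mathbb{R}^n$ is, for $d\in\mathscr V_D$, $$[T_{\mathrm m,\vartheta}(v)]_d=\log\min_{t:(d,t)\in\mathscr E}\ \max_{p:(t,p)\in\mathscr E}\Big(\vartheta\exp(v_d)+\sum_{d':(p,d')\in\mathscr E}m_{p,d'}\exp(v_{d'})\Big).$$ *)

(* Defs.v *)
From HB Require Import structures.
From mathcomp Require Import all_boot all_order all_algebra.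
From mathcomp Require Import all_classical all_reals all_analysis.
Set Implicit Arguments.
Unset Strict Implicit.
Unset Printing Implicit Defensive.
Import Order.TTheory GRing.Theory Num.Theory.
Local Open Scope ring_scope.

(* Minimum and maximum of a real-valued family over a nonempty finite index
   set; the nonemptiness proof only provides a starting point, the value does
   not depend on it. *)
Definition fin_min (R : realType) (I : finType) (P : pred I)
  (hP : exists i, P i) (F : I -> R) : R :=
  F [arg min_(i < xchoose hP | P i) F i]%O.

Definition fin_max (R : realType) (I : finType) (P : pred I)
  (hP : exists i, P i) (F : I -> R) : R :=
  F [arg max_(i > xchoose hP | P i) F i]%O.

Definition hilbert_seminorm (R : realType) (I : finType)
  (hI : exists i : I, true) (x : {ffun I -> R}) : R :=
  fin_max hI x - fin_min hI x.

Definition is_minimum (S : nat -> Prop) (m : nat) : Prop :=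
  S m /\ forall m', S m' -> (m <= m')%N.

(* The three-part vertex set is the disjoint union of the three finite types
   [despot], [tribune] and [people]. The multiplicity is extended by 0 to the
   non-edges, so that [mult_gt0] says that it is positive exactly on edges. *)
Record entropy_game := EntropyGame {
  despot : finType;
  tribune : finType;
  people : finType;
  despot_ne : exists d : despot, true;
  tribune_ne : exists t : tribune, true;
  people_ne : exists p : people, true;
  edgeDT : despot -> tribune -> bool;
  edgeTP : tribune -> people -> bool;
  edgePD : people -> despot -> bool;
  despot_out : forall d, exists t, edgeDT d t;
  tribune_out : forall t, exists p, edgeTP t p;
  people_out : forall p, exists d, edgePD p d;
  mult : people -> despot -> nat;
  mult_gt0 : forall p d, (0 < mult p d)%N = edgePD p d
}.

Definition despot_policy (G : entropy_game) : finType :=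
  {s : {ffun despot G -> tribune G} | [forall d, edgeDT d (s d)]}.

Definition tribune_policy (G : entropy_game) : finType :=
  {s : {ffun tribune G -> people G} | [forall t, edgeTP t (s t)]}.

Definition policies (G : entropy_game) : finType :=
  (despot_policy G * tribune_policy G)%type.

(* The states of Despot are numbered by [enum_val]. *)
Definition policy_mx (G : entropy_game) (q : policies G) :
    'M[nat]_#|despot G| :=
  \matrix_(i, j) mult (val q.2 (val q.1 (enum_val i))) (enum_val j).

(* Strong connectedness of the digraph of the nonzero entries. *)
Definition irreducible_mx (n : nat) (M : 'M[nat]_n) : Prop :=
  forall i j, connect (fun a b => 0 < M a b)%N i j.

Definition irreducible_game (G : entropy_game) : Prop :=
  forall q : policies G, irreducible_mx (policy_mx q).

Definition is_min_offdiag (G : entropy_game) : nat -> Prop :=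
  is_minimum (fun m => exists (q : policies G) i j,
    [/\ i != j, policy_mx q i j != 0%N & m = policy_mx q i j]).

Definition is_irreducibility_index (G : entropy_game) (theta : nat) :
    nat -> Prop :=
  is_minimum (fun k => forall (s : k.-tuple (policies G)) i j,
    (0 < (\prod_(q <- s) (theta%:M + policy_mx q))%R i j)%N).

Definition l_ambiguity (G : entropy_game) (l : nat) : nat :=
  (\max_(i < #|despot G|) \max_(j < #|despot G|)
    \max_(s : l.-tuple (policies G)) (\prod_(q <- s) policy_mx q)%R i j)%N.

(* All terms are nonnegative, hence the default value 0. *)
Definition ambiguity (R : realType) (G : entropy_game) (k : nat) : R :=
  \big[Num.max/0]_(1 <= l < k.+1) (l_ambiguity G l)%:R `^ (l%:R^-1).

Definition mult_km (R : realType) (G : entropy_game) (theta : R)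
    (v : {ffun despot G -> R}) : {ffun despot G -> R} :=
  [ffun d => ln (fin_min (despot_out d) (fun t =>
     fin_max (tribune_out t) (fun p =>
       theta * expR (v d) +
       \sum_(d' | edgePD p d') (mult p d')%:R * expR (v d'))))].

(* Main.v *)
Require Import Defs.
From HB Require Import structures.
From mathcomp Require Import all_boot all_order all_algebra.
From mathcomp Require Import all_classical all_reals all_analysis.
From mathcomp Require Import ring lra.

(** Fix two points [x] and [y].  At each of the [k] steps one can choose a
pair of policies [q] such that the game operator is dominated by the matrix
[m I + M_q] along the orbit of [x] and dominates it along the orbit of [y]:
Despot plays optimally for the orbit of [y], Tribune replies optimally for the
orbit of [x] ([saddle_policies]).  As these matrices are nonnegative, the
choices compose ([iterated_saddle_policies]), and each coordinate of
[T^k x - T^k y] is at most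
[ln (sum_j f_j exp x_j) - ln (sum_j f_j exp y_j)], where [f] is a row of a
product of [k] matrices [m I + M_q] ([iterated_km_gap]).

Hilbert's seminorm of [T^k x - T^k y] is the difference between its largest
and its smallest coordinate.  The lemma is used for the former, and once more
with [x] and [y] exchanged for the latter.  The two rows [f] and [g] obtained
in this way come from different sequences of policies, hence from different
matrices; so what is needed is a form of the Birkhoff-Hopf contraction theorem
for two unrelated positive rows ([birkhoff_two_rows]).  Along the segment from
[y] to [x], the derivative of [ln (sum f exp) - ln (sum g exp)] is the
difference of two weighted means of [x - y], and the total variation distance
of the two weights is at most [(r - 1) / (r + 1)] when the cross ratios of [f]
and [g] are at most [r ^ 2] ([weighted_mean_gap]).

It remains to see that [r = Mbar] is possible, that is, that all entries of
the [k]-fold products lie between [m ^ k] and [(m + A) ^ k], where [A] is the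
ambiguity ([prod_step_bounds]).  A positive entry is a sum of products of
natural numbers, at least one term of which is positive, and every nonzero
entry of [m I + M_q] is at least [m]; the products of length [k] have only
positive entries by the choice of [k].  The upper bound comes from expanding
the product: a word of length [l] in the [M_q] has entries at most
[A_l <= A ^ l], and the binomial formula sums these bounds up. *)

Set Implicit Arguments.
Unset Strict Implicit.
Unset Printing Implicit Defensive.
Import Order.TTheory GRing.Theory Num.Theory.
Local Open Scope ring_scope.

(** * A contraction estimate for two positive rows *)

(** Here [P] and [P'] are the masses that a first weight gives to a set and to
its complement, and [Q], [Q'] those of a second weight.  With [X = P * Q'] and
[Y = P' * Q] the left-hand side is [(X - Y) / (X + Y + Z)] with
[Z >= 2 sqrt (X Y)].  If [X >= Y], this is at most
[(sqrt X - sqrt Y) / (sqrt X + sqrt Y)], which increases with [X / Y]; if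
[X < Y], it is negative. *)
Lemma two_block_gap (R : realFieldType) (r P P' Q Q' : R) :
  1 <= r -> 0 <= P -> 0 <= P' -> 0 <= Q -> 0 <= Q' ->
  0 < P + P' -> 0 < Q + Q' -> P * Q' <= r ^+ 2 * (P' * Q) ->
  P / (P + P') - Q / (Q + Q') <= (r - 1) / (r + 1).
Proof.
move=> r1 P0 P'0 Q0 Q'0 SP SQ cr.
have r0 : 0 < r + 1 by lra.
have -> : P / (P + P') - Q / (Q + Q') =
    (P * Q' - P' * Q) / ((P + P') * (Q + Q')).
  by field; rewrite !gt_eqF.
rewrite ler_pdivrMr ?mulr_gt0// mulrAC ler_pdivlMr//.
set X := P * Q' in cr *; set Y := P' * Q in cr *.
have X0 : 0 <= X by rewrite mulr_ge0.
have Y0 : 0 <= Y by rewrite mulr_ge0.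
set Z := P * Q + P' * Q'.
have Z0 : 0 <= Z by rewrite addr_ge0 ?mulr_ge0.
have XYZ : 4 * (X * Y) <= Z ^+ 2.
  have := sqr_ge0 (P * Q - P' * Q').
  rewrite /X /Y /Z => h; rewrite -subr_ge0; apply: le_trans h _.
  by rewrite le_eqVlt; apply/orP; left; apply/eqP; ring.
have -> : (P + P') * (Q + Q') = X + Y + Z by rewrite /X /Y /Z; ring.
(* Clearing denominators leaves a bound on [Z], which is compared after
   squaring in order to avoid the square root of [X * Y]. *)
suff : 2 * (X - r * Y) <= (r - 1) * Z by lra.
have rZ : 0 <= (r - 1) * Z by rewrite mulr_ge0// subr_ge0.
have [XrY|rYX] := lerP (X - r * Y) 0; first by apply: le_trans rZ; lra.
rewrite -(@ler_pXn2r _ 2) ?nnegrE//; last by lra.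
have YX : Y <= X by have := ler_peMl Y0 r1; lra.
rewrite !exprMn; apply: (@le_trans _ _ ((r - 1) ^+ 2 * (4 * (X * Y)))); last first.
  by rewrite ler_wpM2l ?sqr_ge0.
rewrite -subr_ge0.
have -> : (r - 1) ^+ 2 * (4 * (X * Y)) - 2 ^+ 2 * (X - r * Y) ^+ 2 =
  4 * ((X - Y) * (r ^+ 2 * Y - X)) by ring.
by rewrite mulr_ge0// mulr_ge0 ?subr_ge0.
Qed.

(** Changing the weight of a mean changes it by at most the total variation
distance of the normalized weights times the oscillation of [z].  That distance
is attained on the set where the first normalized weight is the larger one,
and the cross ratio bound for the masses of this set and of its complement is
the sum of the entrywise ones. *)
Lemma weighted_mean_gap (R : realFieldType) (I : finType) (i0 : I)
    (r lo hi : R) (p q z : I -> R) :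
  1 <= r -> (forall i, 0 < p i) -> (forall i, 0 < q i) ->
  (forall i j, p i * q j <= r ^+ 2 * (p j * q i)) ->
  (forall i, lo <= z i <= hi) ->
  (\sum_i p i * z i) / \sum_i p i - (\sum_i q i * z i) / \sum_i q i
  <= (r - 1) / (r + 1) * (hi - lo).
Proof.
move=> r1 p0 q0 cr zb.
have sum0 (f : I -> R) : (forall i, 0 < f i) -> 0 < \sum_i f i.
  move=> f0; rewrite (bigD1 i0)//= ltr_pwDl// sumr_ge0// => i _; exact: ltW.
set Sp := \sum_i p i; set Sq := \sum_i q i.
have Sp0 : 0 < Sp := sum0 _ p0; have Sq0 : 0 < Sq := sum0 _ q0.
pose d i := p i / Sp - q i / Sq.
have dE (S : pred I) :
    \sum_(i | S i) d i = (\sum_(i | S i) p i) / Sp - (\sum_(i | S i) q i) / Sq.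
  by rewrite !mulr_suml -sumrB.
have d0 : \sum_i d i = 0.
  by rewrite dE !divff ?gt_eqF// subrr.
have -> : (\sum_i p i * z i) / Sp - (\sum_i q i * z i) / Sq = \sum_i d i * z i.
  by rewrite !mulr_suml -sumrB; apply: eq_bigr => i _; rewrite /d; ring.
set S : pred I := fun i => 0 < d i.
have osc0 : 0 <= hi - lo by have /andP[h1 h2] := zb i0; lra.
have dz : \sum_i d i * z i <= (\sum_(i | S i) d i) * (hi - lo).
  (* The differences [d] sum to zero, so [lo] times their sum may be added. *)
  rewrite -[leRHS]addr0 -[X in _ + X](mul0r lo) -[X in _ + X * lo]d0.
  rewrite (bigID S) /= [X in _ + X * lo](bigID S)/= mulrDl addrA -mulrDr subrK.
  rewrite !mulr_suml; apply: lerD; apply: ler_sum => i Si;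
    have /andP[zlo zhi] := zb i.
    by rewrite ler_wpM2l// ltW.
  by rewrite ler_wnM2l// leNgt.
apply: le_trans dz _; apply: ler_wpM2r => //.
have splitS (f : I -> R) :
    \sum_i f i = \sum_(i | S i) f i + \sum_(i | ~~ S i) f i by exact: bigID.
rewrite dE /Sp /Sq !splitS.
have ge0 (f : I -> R) (T : pred I) : (forall i, 0 < f i) -> 0 <= \sum_(i | T i) f i.
  by move=> f0; apply: sumr_ge0 => i _; exact: ltW.
apply: two_block_gap => //; rewrite ?ge0 //.
- by rewrite -splitS.
- by rewrite -splitS.
rewrite [X in _ <= _ * X]mulrC !big_distrlr mulr_sumr/=.
apply: ler_sum => i _; rewrite mulr_sumr; apply: ler_sum => j _.
by rewrite [q i * _]mulrC.
Qed.

Lemma is_derive_ln_sum_exp (R : realType) (n : nat) (i0 : 'I_n)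
    (f y z : 'I_n -> R) (s : R) : (forall i, 0 < f i) ->
  is_derive s 1 (fun s => ln (\sum_(i < n) f i * expR (y i + s * z i)))
    ((\sum_(i < n) f i * expR (y i + s * z i) * z i) /
     \sum_(i < n) f i * expR (y i + s * z i)).
Proof.
move=> f0.
pose u (i : 'I_n) : R -> R := fun t => f i * expR (y i + t * z i).
have du i : is_derive s (1 : R) (u i) (u i s * z i).
  have -> : u i = f i \*: (expR \o (cst (y i) + z i \*: id)).
    by apply/funext => t /=; rewrite /u /= !fctE /= [t * _]mulrC.
  apply: is_derive_eq.
  by rewrite !fctE /= /GRing.scale /= add0r mulr1 mulrA.
have usum t : (\sum_(i < n) u i) t = \sum_(i < n) f i * expR (y i + t * z i).
  by rewrite fct_sumE.
have s0 : 0 < (\sum_(i < n) u i) s.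
  rewrite usum (bigD1 i0)//= ltr_pwDl ?mulr_gt0 ?expR_gt0// sumr_ge0// => i _.
  by rewrite mulr_ge0 ?expR_ge0// ltW.
have -> : (fun t => ln (\sum_(i < n) f i * expR (y i + t * z i))) =
    @ln R \o (\sum_(i < n) u i).
  by apply/funext => t /=; rewrite usum.
apply: is_derive_eq; first by apply: is_derive1_comp; exact: is_derive1_ln.
by rewrite usum mulrC.
Qed.

(** The mean value theorem on the segment from [y] to [x].  Reweighting [f] and
[g] by the same exponentials does not change their cross ratios, so that the
bound of [weighted_mean_gap] is uniform along the segment. *)
Lemma birkhoff_two_rows (R : realType) (n : nat) (i0 : 'I_n)
    (r lo hi : R) (f g x y : 'I_n -> R) :
  1 <= r -> (forall i, 0 < f i) -> (forall i, 0 < g i) ->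
  (forall i j, f i * g j <= r ^+ 2 * (f j * g i)) ->
  (forall i, lo <= x i - y i <= hi) ->
  (ln (\sum_i f i * expR (x i)) - ln (\sum_i f i * expR (y i))) -
  (ln (\sum_i g i * expR (x i)) - ln (\sum_i g i * expR (y i)))
  <= (r - 1) / (r + 1) * (hi - lo).
Proof.
move=> r1 f0 g0 cr xy.
pose z i := x i - y i.
pose F (h : 'I_n -> R) s := ln (\sum_(i < n) h i * expR (y i + s * z i)).
pose dF (h : 'I_n -> R) s := (\sum_(i < n) h i * expR (y i + s * z i) * z i) /
     \sum_(i < n) h i * expR (y i + s * z i).
have F1 h : F h 1 = ln (\sum_i h i * expR (x i)).
  by congr ln; apply: eq_bigr => i _; rewrite mul1r /z addrC subrK.
have F0 h : F h 0 = ln (\sum_i h i * expR (y i)).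
  by congr ln; apply: eq_bigr => i _; rewrite mul0r addr0.
have dFG s : is_derive s (1 : R) (F f - F g) (dF f s - dF g s).
  by apply: is_deriveB; exact: is_derive_ln_sum_exp.
have [|c _] := MVT ltr01 (fun s _ => dFG s).
  by apply: derivable_within_continuous => s _; exact: ex_derive.
rewrite subr0 mulr1 !fctE !F1 !F0 => e.
apply: (@le_trans _ _ (dF f c - dF g c)); first by rewrite -e; lra.
apply: weighted_mean_gap => // [i|i|i j]; rewrite ?mulr_gt0 ?expR_gt0//.
pose w l := expR (y l + c * z l).
have wij : 0 <= w i * w j by rewrite mulr_ge0 ?expR_ge0.
have := ler_wpM2r wij (cr i j); rewrite /w; lra.
Qed.

(** * The operator as a min-max over policies *)

Lemma fin_max_attained (R : realType) (I : finType) (P : pred I)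
    (hP : exists i, P i) (F : I -> R) : exists2 i, P i & fin_max hP F = F i.
Proof.
by rewrite /fin_max; case: arg_maxP => [|i Pi _]; [exact: xchooseP | exists i].
Qed.

Lemma fin_max_ge (R : realType) (I : finType) (P : pred I)
    (hP : exists i, P i) (F : I -> R) i : P i -> F i <= fin_max hP F.
Proof.
by move=> Pi; rewrite /fin_max; case: arg_maxP => [|j _]; [exact: xchooseP | apply].
Qed.

Lemma fin_min_attained (R : realType) (I : finType) (P : pred I)
    (hP : exists i, P i) (F : I -> R) : exists2 i, P i & fin_min hP F = F i.
Proof.
by rewrite /fin_min; case: arg_minP => [|i Pi _]; [exact: xchooseP | exists i].
Qed.

Lemma fin_min_le (R : realType) (I : finType) (P : pred I)
    (hP : exists i, P i) (F : I -> R) i : P i -> fin_min hP F <= F i.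
Proof.
by move=> Pi; rewrite /fin_min; case: arg_minP => [|j _]; [exact: xchooseP | apply].
Qed.

Definition step_mx (G : entropy_game) (m : nat) (q : policies G) :
  'M[nat]_#|despot G| := m%:M + policy_mx q.

(** The coordinates of the vector [A (exp u)]. *)
Definition exp_act (R : realType) (G : entropy_game) (A : 'M[nat]_#|despot G|)
    (u : {ffun despot G -> R}) (i : 'I_#|despot G|) : R :=
  \sum_j (A i j)%:R * expR (u (enum_val j)).

Lemma exp_act_mul (R : realType) (G : entropy_game) (A B : 'M[nat]_#|despot G|)
    (u : {ffun despot G -> R}) i :
  exp_act (A * B) u i = \sum_l (A i l)%:R * exp_act B u l.
Proof.
under [RHS]eq_bigr do rewrite mulr_sumr.
rewrite exchange_big /=; apply: eq_bigr => j _.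
rewrite mxE raddf_sum mulr_suml; apply: eq_bigr => l _.
by rewrite mulrA; congr (_ * _); exact: natrM.
Qed.

Lemma exp_act1 (R : realType) (G : entropy_game)
    (u : {ffun despot G -> R}) i : exp_act 1 u i = expR (u (enum_val i)).
Proof.
rewrite /exp_act (bigD1 i)//= big1 ?addr0 => [|j ji]; rewrite mxE ?eqxx ?mul1r//.
by rewrite eq_sym (negbTE ji) mul0r.
Qed.

Lemma sum_edgePD (R : realType) (G : entropy_game) (u : {ffun despot G -> R}) p :
  \sum_(d | edgePD p d) (mult p d)%:R * expR (u d) =
  \sum_d (mult p d)%:R * expR (u d).
Proof.
rewrite [RHS](bigID (edgePD p))/= [X in _ = _ + X]big1 ?addr0// => d.
by rewrite -mult_gt0 lt0n negbK => /eqP->; rewrite mul0r.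
Qed.

Lemma exp_act_step (R : realType) (G : entropy_game) m q
    (u : {ffun despot G -> R}) i :
  exp_act (step_mx m q) u i = m%:R * expR (u (enum_val i)) +
    \sum_(d | edgePD (val q.2 (val q.1 (enum_val i))) d)
      (mult (val q.2 (val q.1 (enum_val i))) d)%:R * expR (u d).
Proof.
rewrite sum_edgePD /exp_act.
under eq_bigr do rewrite !mxE natrD mulrDl.
rewrite big_split /=; congr (_ + _).
  rewrite (bigD1 i)//= eqxx mulr1n big1 ?addr0// => j ji.
  by rewrite eq_sym (negbTE ji) mulr0n mul0r.
by rewrite [RHS](reindex _ (onW_bij _ (@enum_val_bij (despot G)))).
Qed.

Lemma expR_mult_km (R : realType) (G : entropy_game) (theta : R)
    (u : {ffun despot G -> R}) d : 0 < theta ->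
  expR (mult_km theta u d) =
  fin_min (despot_out d) (fun t =>
     fin_max (tribune_out t) (fun p =>
       theta * expR (u d) +
       \sum_(d' | edgePD p d') (mult p d')%:R * expR (u d'))).
Proof.
move=> t0; rewrite ffunE lnK// posrE.
set f := (X in fin_min _ X).
have [t _ ->] := fin_min_attained (despot_out d) f; rewrite /f.
set g := (X in fin_max _ X).
have [p _ ->] := fin_max_attained (tribune_out t) g; rewrite /g.
by rewrite ltr_pwDl ?mulr_gt0 ?expR_gt0// sumr_ge0.
Qed.

(** Despot's choice minimizes the value at [w], Tribune's maximizes the payoff
at [u].  The latter is a policy, a function of the Tribune state alone, because
the term [m * expR (u d)] is common to all the moves compared and does not
influence which of them is best. *)
Lemma saddle_policies (R : realType) (G : entropy_game) (m : nat)
    (u w : {ffun despot G -> R}) : (0 < m)%N ->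
  exists q : policies G, forall i,
    expR (mult_km m%:R u (enum_val i)) <= exp_act (step_mx m q) u i /\
    exp_act (step_mx m q) w i <= expR (mult_km m%:R w (enum_val i)).
Proof.
move=> m0; have mR : 0 < m%:R :> R by rewrite ltr0n.
pose pay (v : {ffun despot G -> R}) p :=
  \sum_(d | edgePD p d) (mult p d)%:R * expR (v d).
pose val_w d t := fin_max (tribune_out t)
  (fun p => m%:R * expR (w d) + pay w p).
have /choice[s sP] d : exists t, edgeDT d t /\
    fin_min (despot_out d) (val_w d) = val_w d t.
  by have [t ? ?] := fin_min_attained (despot_out d) (val_w d); exists t.
have /choice[b bP] t : exists p, edgeTP t p /\
    fin_max (tribune_out t) (pay u) = pay u p.
  by have [p ? ?] := fin_max_attained (tribune_out t) (pay u); exists p.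
have sE : [forall d, edgeDT d ([ffun d => s d] d)].
  by apply/forallP => d; rewrite ffunE; case: (sP d).
have bE : [forall t, edgeTP t ([ffun t => b t] t)].
  by apply/forallP => t; rewrite ffunE; case: (bP t).
exists (Sub [ffun d => s d] sE, Sub [ffun t => b t] bE) => i.
rewrite !exp_act_step !expR_mult_km// !SubK /= !ffunE; set d := enum_val i.
split.
  apply: le_trans (fin_min_le (i := s d) _ _ _) _; first by case: (sP d).
  set g := (X in fin_max _ X).
  have [p tp ->] := fin_max_attained (tribune_out (s d)) g; rewrite /g.
  rewrite lerD2l -[leRHS]/(pay u (b (s d))); have [_ <-] := bP (s d).
  exact: fin_max_ge.
have [_ ->] := sP d.
apply: (fin_max_ge (tribune_out (s d)) (fun p => m%:R * expR (w d) + pay w p)).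
by case: (bP (s d)).
Qed.

(** The policies of each step are chosen at the current points of the two
orbits; the inequalities compose because nonnegative matrices are monotone. *)
Lemma iterated_saddle_policies (R : realType) (G : entropy_game) (m k : nat)
    (x y : {ffun despot G -> R}) : (0 < m)%N ->
  exists s : k.-tuple (policies G), forall i,
    expR (iter k (mult_km m%:R) x (enum_val i)) <=
      exp_act (\prod_(q <- s) step_mx m q) x i /\
    exp_act (\prod_(q <- s) step_mx m q) y i <=
      expR (iter k (mult_km m%:R) y (enum_val i)).
Proof.
move=> m0; elim: k => [|k [s IH]].
  by exists [tuple] => i; rewrite big_nil !exp_act1.
have [q qP] := saddle_policies (iter k (mult_km m%:R) x)
  (iter k (mult_km m%:R) y) m0.
exists [tuple of q :: s] => i; rewrite big_cons !exp_act_mul /=.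
have [qx qy] := qP i; split.
  apply: le_trans qx _; apply: ler_sum => l _.
  by rewrite ler_wpM2l//; case: (IH l).
apply: le_trans qy; apply: ler_sum => l _.
by rewrite ler_wpM2l//; case: (IH l).
Qed.

(** * Entries of products of shifted policy matrices *)

Lemma min_offdiag_gt0 (G : entropy_game) m : is_min_offdiag G m -> (0 < m)%N.
Proof. by move=> [[q [i [j [_ nz ->]]]] _]; rewrite lt0n. Qed.

(** A positive entry of a product contains a path of nonzero entries.  Each of
these is at least [m]: off the diagonal by minimality of [m], on the diagonal
thanks to the shift. *)
Lemma prod_step_ge (G : entropy_game) m (s : seq (policies G)) i j :
  is_min_offdiag G m -> (0 < (\prod_(q <- s) step_mx m q)%R i j)%N ->
  (m ^ size s <= (\prod_(q <- s) step_mx m q)%R i j)%N.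
Proof.
move=> hm; elim: s i j => [|q s IH] i j /=; first by rewrite big_nil.
rewrite big_cons mxE.
rewrite lt0n sum_nat_eq0 negb_forall => /existsP[l].
rewrite /= muln_eq0 negb_or -!lt0n => /andP[ql sl].
rewrite (bigD1 l)//= expnS; apply: leq_trans (leq_addr _ _).
apply: leq_mul; last exact: IH.
move: ql; rewrite !mxE; have [<-|il] := eqVneq i l.
  by rewrite mulr1n leq_addr.
rewrite mulr0n add0r => ql; apply: hm.2.
by exists q, i, l; rewrite !mxE -lt0n.
Qed.

Lemma ambiguity_ge0 (R : realType) (G : entropy_game) k : 0 <= ambiguity R G k.
Proof. exact: bigmax_ge_id. Qed.

(** For length [l > 0] the entry is at most [A_l], whose [l]-th root is one of
the terms of the maximum that defines the ambiguity; for the empty product the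
bound is that of the entries of the identity matrix. *)
Lemma prod_policy_le (R : realType) (G : entropy_game) k (s : seq (policies G)) i j :
  (size s <= k)%N ->
  ((\prod_(q <- s) policy_mx q)%R i j)%:R <= ambiguity R G k ^+ size s.
Proof.
case: s => [_|q s sk]; first by rewrite big_nil expr0 mxE lern1; case: (_ == _).
set l := size (q :: s) in sk *.
have l0 : l%:R != 0 :> R by rewrite pnatr_eq0.
have A0 := ambiguity_ge0 R G k.
rewrite -powR_mulrn//.
have le_l : ((\prod_(p <- q :: s) policy_mx p)%R i j <= l_ambiguity G l)%N.
  rewrite -[q :: s]/(val (in_tuple (q :: s))).
  apply: leq_trans (leq_bigmax i); apply: leq_trans (leq_bigmax j).
  exact: (leq_bigmax (F := fun s : l.-tuple (policies G) =>
    (\prod_(q <- s) policy_mx q)%R i j) (in_tuple (q :: s))).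
have rootK (a : R) : 0 <= a -> (a `^ l%:R^-1) `^ l%:R = a.
  by move=> a0; rewrite -powRrM mulVf// powRr1.
rewrite -[leLHS]rootK//.
apply: ge0_ler_powR; rewrite ?nnegrE ?powR_ge0//.
apply: (@le_trans _ _ ((l_ambiguity G l)%:R `^ l%:R^-1)).
  by apply: ge0_ler_powR; rewrite ?nnegrE ?invr_ge0// ler_nat.
apply: (le_bigmax_seq 0 l xpredT (fun l => (l_ambiguity G l)%:R `^ l%:R^-1)) => //.
by rewrite mem_index_iota.
Qed.

(** The binomial expansion of the product over [s], done one factor at a time:
the first factor [m I + M_q] either contributes the scalar [m] or moves [M_q]
to the prefix [r].  The condition on the sizes keeps every prefix short enough
for [prod_policy_le]. *)
Lemma prod_policy_step_le (R : realType) (G : entropy_game) m k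
    (r s : seq (policies G)) i j : (size r + size s <= k)%N ->
  (((\prod_(q <- r) policy_mx q) * \prod_(q <- s) step_mx m q)%R i j)%:R
  <= ambiguity R G k ^+ size r * (m%:R + ambiguity R G k) ^+ size s.
Proof.
elim: s r => [|q s IH] r /= sk.
  by rewrite big_nil !mulr1 prod_policy_le// -(addn0 (size r)).
have scal (A B : 'M[nat]_#|despot G|) : A * m%:M * B = m *: (A * B).
  by rewrite -[LHS]/(A *m m%:M *m B) mul_mx_scalar -scalemxAl.
rewrite big_cons mulrA [X in _ * X * _]/step_mx mulrDr mulrDl scal.
rewrite mxE [X in X + _]mxE natrD natrM exprS mulrDl mulrDr mulrCA.
apply: lerD.
  by rewrite ler_wpM2l// IH// (leq_trans _ sk)// leq_add2l.
have := IH (rcons r q); rewrite -cats1 big_cat big_seq1 size_cat /= addn1 addSnnS.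
by move=> /(_ sk); rewrite exprSr -[leRHS]mulrA.
Qed.

Lemma prod_step_bounds (R : realType) (G : entropy_game) m k
    (s : k.-tuple (policies G)) i j :
  is_min_offdiag G m -> is_irreducibility_index G m k ->
  (m%:R : R) ^+ k <= ((\prod_(q <- s) step_mx m q)%R i j)%:R
    <= (m%:R + ambiguity R G k) ^+ k.
Proof.
move=> hm hk; apply/andP; split.
  rewrite -natrX ler_nat -[X in (_ ^ X)%N](size_tuple s) prod_step_ge//.
  exact: hk.1.
have := @prod_policy_step_le R G m k [::] s i j.
by rewrite big_nil expr0 !mul1r size_tuple; exact.
Qed.

(** * Contraction *)

(** The row [f] is a row of the matrix of [iterated_saddle_policies], whose
policies depend on the order of the two points.  Exchanging [x] and [y]
therefore gives a lower bound with another row, not with the same one. *)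
Lemma iterated_km_gap (R : realType) (G : entropy_game) (m k : nat)
    (x y : {ffun despot G -> R}) (i : 'I_#|despot G|) : is_min_offdiag G m ->
  is_irreducibility_index G m k ->
  exists f : 'I_#|despot G| -> R,
   (forall j, m%:R ^+ k <= f j <= (m%:R + ambiguity R G k) ^+ k) /\
   iter k (mult_km m%:R) x (enum_val i) - iter k (mult_km m%:R) y (enum_val i) <=
   ln (\sum_j f j * expR (x (enum_val j))) - ln (\sum_j f j * expR (y (enum_val j))).
Proof.
move=> hm hk; have m0 := min_offdiag_gt0 hm.
have [s sP] := iterated_saddle_policies k x y m0.
exists (fun j => ((\prod_(q <- s) step_mx m q)%R i j)%:R); split=> [j|].
  exact: prod_step_bounds.
have act_gt0 u : 0 < exp_act (\prod_(q <- s) step_mx m q) u i :> R.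
  rewrite /exp_act (bigD1 i)//= ltr_pwDl ?sumr_ge0// mulr_gt0 ?expR_gt0//.
  by rewrite ltr0n; exact: hk.1.
have [sx sy] := sP i; apply: lerB.
  by rewrite -[leLHS]expRK ler_ln ?posrE ?expR_gt0 ?act_gt0.
by rewrite -[leRHS]expRK ler_ln ?posrE ?expR_gt0 ?act_gt0.
Qed.

Unset Implicit Arguments.

Theorem theorem24 (R : realType) (G : entropy_game) (m k : nat)
  (hG : irreducible_game G)
  (hm : is_min_offdiag G m)
  (hk : is_irreducibility_index G m k)
  (x y : {ffun despot G -> R}) :
  let Mbar : R := (1 + ambiguity R G k / m%:R) ^+ k in
  hilbert_seminorm (despot_ne G)
    (iter k (mult_km m%:R) x - iter k (mult_km m%:R) y)
  <= (Mbar - 1) / (Mbar + 1) * hilbert_seminorm (despot_ne G) (x - y).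
Proof.
cbv zeta; set Mbar := (1 + _) ^+ k.
have m0 : 0 < m%:R :> R by rewrite ltr0n (min_offdiag_gt0 hm).
set A := ambiguity R G k in Mbar *.
have A0 : 0 <= A := ambiguity_ge0 R G k.
set Tx := iter k _ x; set Ty := iter k _ y.
rewrite /hilbert_seminorm.
have [d _ ->] := fin_max_attained (despot_ne G) (Tx - Ty).
have [e _ ->] := fin_min_attained (despot_ne G) (Tx - Ty).
rewrite !ffunE -[d]enum_rankK -[e]enum_rankK.
set i := enum_rank d; set j := enum_rank e.
(* [f] bounds the largest coordinate of [Tx - Ty] from above, and [g], for the
   exchanged points, bounds the smallest one from below. *)
have [f [fb fxy]] := iterated_km_gap x y i hm hk.
have [g [gb gyx]] := iterated_km_gap y x j hm hk.
set a := m%:R ^+ k in fb gb; set b := (m%:R + A) ^+ k in fb gb.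
have a0 : 0 < a by rewrite exprn_gt0.
have bE : b = Mbar * a.
  by rewrite /b /Mbar /a -exprMn mulrDl mul1r divfK ?gt_eqF.
have M1 : 1 <= Mbar by rewrite exprn_ege1// lerDl divr_ge0// ltW.
have f0 l : 0 < f l by have /andP[h _] := fb l; exact: lt_le_trans h.
have g0 l : 0 < g l by have /andP[h _] := gb l; exact: lt_le_trans h.
have cr l l' : f l * g l' <= Mbar ^+ 2 * (f l' * g l).
  apply: (@le_trans _ _ (b * b)).
    by apply: ler_pM; [exact: ltW|exact: ltW|case/andP: (fb l)|case/andP: (gb l')].
  rewrite bE mulrACA -expr2 ler_wpM2l ?sqr_ge0//.
  by apply: ler_pM; [exact: ltW|exact: ltW|case/andP: (fb l')|case/andP: (gb l)].
have osc (l : 'I_#|despot G|) : fin_min (despot_ne G) (x - y) <=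
    x (enum_val l) - y (enum_val l) <= fin_max (despot_ne G) (x - y).
  have -> : x (enum_val l) - y (enum_val l) = (x - y) (enum_val l).
    by rewrite !ffunE.
  by rewrite fin_min_le// fin_max_ge.
apply: le_trans (birkhoff_two_rows i M1 f0 g0 cr osc).
move: fxy gyx; rewrite -/Tx -/Ty; lra.
Qed.
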